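(* Let $S$ be a finite set in $\mathbb{R}^d$ and let $M$ be a matroid complex with rank function $\rho$ and vertex set $V$. For each $v\in V$ let $B_v$ be an axis-parallel box in $\mathbb{R}^d$. Suppose that for each independent set $U\subset V$ of $M$ there is a point of $S$ in $\bigcap_{v\in U}B_v$. Then there exists a set $T\subset V$ such that $\rho(V\setminus T)\le 2d-1$ and there is a point of $S$ in $\bigcap_{v\in T}B_v$.
   Context: An axis-parallel box in $\mathbb{R}^d$ is a set of the form $[a_1,b_1]\times\cdots\times[a_d,b_d]$ with $a_i\le b_i$ real numbers. A matroid complex on vertex set $V$ is the simplicial complex whose faces are the independent sets of a matroid on the ground set $V$; $\rho$ denotes the rank function of that matroid. *)

(* Defs.v *)
From mathcomp Require Import all_boot all_order all_algebra.
From mathcomp Require Import boolp classical_sets cardinality reals.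

Set Implicit Arguments.
Unset Strict Implicit.
Unset Printing Implicit Defensive.

Import Order.TTheory GRing.Theory Num.Theory.
Local Open Scope ring_scope.

(* Matroids may have loops: [set v] is not required to be independent. *)
Record matroid (V : finType) := Matroid {
  indep : {set {set V}};
  indep0 : finset.set0 \in indep;
  indep_sub : forall A B : {set V},
    A \subset B -> B \in indep -> A \in indep;
  indep_aug : forall A B : {set V},
    A \in indep -> B \in indep -> (#|A| < #|B|)%N ->
    exists2 x, x \in B :\: A & x |: A \in indep
}.

Definition mrank (V : finType) (M : matroid V) (A : {set V}) : nat :=
  \max_(U in indep M | U \subset A) #|U|.

Definition axis_box (R : realType) (d : nat) (B : set 'rV[R]_d) : Prop :=
  exists a b : 'rV[R]_d,
    (forall i, a 0 i <= b 0 i) /\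
    B = [set x : 'rV[R]_d | forall i, a 0 i <= x 0 i <= b 0 i]%classic.

(* Main.v *)
Require Import Defs.
From mathcomp Require Import all_boot all_order all_algebra.
From mathcomp Require Import boolp classical_sets cardinality reals.

(** Order [S] by the first coordinate and let the optimum of an independent set
    [U] be the first point of [S] lying in all boxes of [U]. Points before the
    optimum automatically satisfy the upper bounds on the first coordinate, so
    the optimum of [U] is already that of at most [2d - 1] members of [U], the
    ones giving the tightest of the other [2d - 1] bounds. Take [U] with the
    latest optimum [x], and let [W] be those members. If [W] can be extended by
    [v] to an independent set, then the optimum can move neither backwards
    (monotonicity) nor forwards (maximality), so the box of [v] contains [x].
    Hence by matroid augmentation the set of [v] whose box misses [x] has rank
    at most [#|W|]. *)

Set Implicit Arguments.
Unset Strict Implicit.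
Unset Printing Implicit Defensive.

Import Order.TTheory GRing.Theory Num.Theory.

Local Open Scope classical_set_scope.

(** A larger independent subset of [A] would augment [W] by an element of [A] outside [W]. *)
Lemma mrank_leq_card (V : finType) (M : matroid V) (W A : {set V}) :
  W \in indep M -> (forall v, v \in A -> v |: W \in indep M -> v \in W) ->
  (mrank M A <= #|W|)%N.
Proof.
move=> WM WA; apply/bigmax_leqP => U /andP[UM UA].
rewrite leqNgt; apply/negP => ltWU.
have [v] := indep_aug WM UM ltWU.
by rewrite finset.in_setD => /andP[/negP vW vU] /WA; move/(_ (fintype.subsetP UA _ vU)).
Qed.

(** The combinatorial core, free of geometry: points are ordered by their position in [s], and
    [find (common U) s] is the position of the optimum of [U]. *)
Lemma matroid_lp_type (V : finType) (M : matroid V) (T : Type) (x0 : T)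
    (s : seq T) (P : V -> pred T) (k : nat) :
  let common (U : {set V}) x := [forall v in U, P v x] in
  (forall U, U \in indep M -> has (common U) s) ->
  (forall U, has (common U) s ->
     exists W : {set V}, [/\ W \subset U, (#|W| <= k)%N &
       (find (common U) s <= find (common W) s)%N]) ->
  exists2 i, (i < size s)%N &
    (mrank M (~: [set v | P v (nth x0 s i)])%SET <= k)%N.
Proof.
move=> common hM basis.
have [U UM Umax] := arg_maxnP (fun U => find (common U) s) (indep0 M).
have [W [WU Wk leUW]] := basis U (hM U UM).
have WM := indep_sub WU UM.
have eqUW : find (common W) s = find (common U) s.
  by apply/eqP; rewrite eqn_leq leUW andbT; exact: Umax.
exists (find (common U) s); first by rewrite -has_find hM.
apply: leq_trans Wk; apply: mrank_leq_card => // v; rewrite !inE => /negP Pv vWM.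
case: Pv; have hvW := hM _ vWM.
suff -> : find (common U) s = find (common (v |: W)%SET) s.
  by have /forall_inP := nth_find x0 hvW; apply; rewrite finset.setU11.
apply/eqP; rewrite eqn_leq; apply/andP; split; last exact: Umax.
rewrite -eqUW; apply: sub_find => x /forall_inP vWx.
by apply/forall_inP => w wW; apply: vWx; rewrite finset.setU1r.
Qed.

Local Open Scope ring_scope.

(** Meant for [x] the optimum of [U] and [y] an earlier point in all boxes of [W]. *)
Lemma box_basis (R : realType) (d : nat) (V : finType) (a b : V -> 'rV[R]_d)
    (U : {set V}) (i0 : 'I_d) :
  exists W : {set V}, [/\ W \subset U, (#|W| <= 2 * d - 1)%N &
    forall x y : 'rV[R]_d, y 0 i0 <= x 0 i0 ->
      (forall v, v \in U -> forall i, a v 0 i <= x 0 i <= b v 0 i) ->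
      (forall v, v \in W -> forall i, a v 0 i <= y 0 i <= b v 0 i) ->
      forall v, v \in U -> forall i, a v 0 i <= y 0 i <= b v 0 i].
Proof.
have [-> | [v0 v0U]] := finset.set_0Vmem U.
  by exists finset.set0; rewrite finset.sub0set cards0; split=> // x y _ _ _ v; rewrite inE.
pose lo i := [arg max_(v > v0 in U) a v 0 i]%O.
pose hi i := [arg min_(v < v0 in U) b v 0 i]%O.
have loP i : lo i \in U /\ forall v, v \in U -> a v 0 i <= a (lo i) 0 i.
  by rewrite /lo; case: arg_maxP.
have hiP i : hi i \in U /\ forall v, v \in U -> b (hi i) 0 i <= b v 0 i.
  by rewrite /hi; case: arg_minP.
(* Tightest lower bounds in all coordinates and tightest upper bounds in all but [i0]: at most
   [d + (d - 1)] members. *)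
exists ((lo @: [set: 'I_d]) :|: (hi @: [set~ i0]))%SET; split.
- by apply/fintype.subsetP => v /finset.setUP[] /imsetP[i _ ->];
    [case: (loP i) | case: (hiP i)].
- apply: leq_trans (leq_card_setU _ _) _.
  have d_gt0 : (0 < d)%N by apply: leq_ltn_trans (ltn_ord i0).
  rewrite mul2n -addnn -addnBA //; apply: leq_add.
    by apply: leq_trans (leq_imset_card _ _) _; rewrite cardsT card_ord.
  by apply: leq_trans (leq_imset_card _ _) _; rewrite cardsC1 card_ord subn1.
- move=> x y yx xU yW v vU i; apply/andP; split.
    have /yW/(_ i)/andP[+ _] : lo i \in ((lo @: [set: 'I_d]) :|: (hi @: [set~ i0]))%SET.
      by rewrite inE imset_f.
    by apply: le_trans; apply: (loP i).2.
  (* In coordinate [i0] the upper bound passes from [x] down to [y]. *)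
  have [-> | ii0] := eqVneq i i0.
    by apply: le_trans yx _; case/andP: (xU v vU i0).
  have /yW/(_ i)/andP[_ le_y] : hi i \in ((lo @: [set: 'I_d]) :|: (hi @: [set~ i0]))%SET.
    by rewrite inE orbC imset_f // !inE.
  by apply: le_trans le_y _; apply: (hiP i).2.
Qed.

Local Close Scope ring_scope.

Theorem theorem3p3 (R : realType) (d : nat) (hd : (0 < d)%N)
  (S : set 'rV[R]_d) (hS : finite_set S)
  (V : finType) (M : matroid V)
  (B : V -> set 'rV[R]_d) (hB : forall v, axis_box (B v))
  (hM : forall U : {set V}, U \in indep M ->
    exists x, S x /\ (\bigcap_(v in [set` U]) B v) x) :
  exists T : {set V},
    (mrank M (~: T)%SET <= 2 * d - 1)%N /\
    exists x, S x /\ (\bigcap_(v in [set` T]) B v) x.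
Proof.
have [a /choice[b abP]] := choice hB.
have BE v x : B v x <-> forall i, (a v 0 i <= x 0 i <= b v 0 i)%R.
  by case: (abP v) => _ {1}->.
pose i0 := Ordinal hd.
pose le0 := [rel x y : 'rV[R]_d | x 0 i0 <= y 0 i0]%R.
have le0_trans : transitive le0 by move=> y x z; exact: le_trans.
have [s0 S0] := (finite_seqP S).1 hS.
pose s := sort le0 s0.
have Ss x : S x <-> x \in s by rewrite mem_sort S0.
have s_sorted : sorted le0 s by apply: sort_sorted => x y; exact: le_total.
pose P v : pred 'rV[R]_d := fun x => `[< B v x >].
have [||i lti rk] := @matroid_lp_type V M _ 0%R s P (2 * d - 1).
- move=> U /hM[x [Sx xU]]; apply/hasP; exists x; first exact/Ss.
  by apply/forall_inP => v vU; apply/asboolP; exact: xU.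
- move=> U hU; have [W [WU Wd WP]] := box_basis a b U i0.
  (* If the optimum of [W] came strictly before that of [U], then by [WP] it would lie in all boxes
     of [U], although the optimum of [U] is the first such point. *)
  exists W; split=> //; rewrite leqNgt; apply/negP => ltWU.
  have hW : has (fun x => [forall v in W, P v x]) s.
    by rewrite has_find (ltn_trans ltWU) // -has_find.
  have /negP := negbT (before_find 0%R ltWU); apply.
  apply/forall_inP => v vU; apply/asboolP/BE => i.
  apply: (WP _ _ _ _ _ v vU i).
  + apply: (sorted_ltn_nth le0_trans 0%R s_sorted _ _ _ _ ltWU);
      by rewrite inE -has_find.
  + have /forall_inP xU := nth_find 0%R hU.
    by move=> w /xU/asboolP/BE; apply.
  + have /forall_inP yW := nth_find 0%R hW.
    by move=> w /yW/asboolP/BE; apply.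
- exists [set v | P v (nth 0%R s i)]%SET; split=> //.
  exists (nth 0%R s i); split; first by apply/Ss; exact: mem_nth.
  by move=> v /=; rewrite inE => /asboolP.
Qed.
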